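(* There exists an absolute constant $C_0$ such that the following holds. Let $A\in\mathbb{R}^{n\times n}$ be a real symmetric matrix, and let $C\in\mathbb{R}^{n\times r}$ be a column subset of $A$ with $n\ge r$, full column rank, and thin SVD $C=U\Sigma V^{\top}$. Let $t$ be an integer with $t\ge C_0\,r\log(2r)$ (so $t$ may be taken of order $r\log r$), let $0<\epsilon<1$ and $\delta\ge 0$, and let $S\in\mathbb{R}^{t\times n}$ be a leverage score sampling matrix of $U$ that is a $(1\pm\epsilon)$ $\ell_2$-subspace embedding for $U$ with probability at least $1-\delta$. Define $$M^*:=\operatorname*{arg\,min}_{M\in\mathbb{R}^{r\times r}}\|A-CMC^{\top}\|_F,\qquad \widehat{M}:=\operatorname*{arg\,min}_{M\in\mathbb{R}^{r\times r}}\|S(A-CMC^{\top})S^{\top}\|_F .$$ Then for every $\Delta>c_4(r,t)\sqrt{r}$, setting $c_5(r,t,\epsilon):=\dfrac{\Delta}{(1-\epsilon)^2\sqrt{r}}$, the inequality $$\|A-C\widehat{M}C^{\top}\|_*\le\bigl(1+c_5(r,t,\epsilon)\sqrt{r}\bigr)\,\|A-CM^*C^{\top}\|_*$$ holds with probability at least $1-\left(\dfrac{c_4(r,t)\sqrt{r}}{\Delta}+\delta\right)$.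
   Context: A column subset of $A$ is a matrix $C=A(:,I)\in\mathbb{R}^{n\times r}$ formed by the columns of $A$ indexed by a set $I\subseteq\{1,\dots,n\}$ with $|I|=r$. $\|\cdot\|_F$ is the Frobenius norm, $\|\cdot\|_*$ the nuclear norm, $\|\cdot\|_2$ the Euclidean vector norm, $\dagger$ the Moore–Penrose pseudoinverse, $\log$ the natural logarithm. In the thin SVD, $U\in\mathbb{R}^{n\times r}$ has orthonormal columns. Leverage score sampling (LSS): for $U\in\mathbb{R}^{n\times r}$ with orthonormal columns, let $\ell_i:=\|U_{i,*}\|_2^2$ be the squared norm of its $i$th row (so $\sum_i\ell_i=r$) and $p_i:=\ell_i/r$. A leverage score sampling matrix $S\in\mathbb{R}^{t\times n}$ of $U$ is obtained by drawing $t$ row indices $j_1,\dots,j_t\in\{1,\dots,n\}$ i.i.d. with probabilities $p_i$; the $m$th row of $S$ is $e_{j_m}^{\top}/\sqrt{t\,p_{j_m}}$, where $e_j$ is the $j$th canonical basis vector of $\mathbb{R}^n$. A matrix $S\in\mathbb{R}^{t\times n}$ is a $(1\pm\epsilon)$ $\ell_2$-subspace embedding for $U$ if $(1-\epsilon)\|Ux\|_2^2\le\|SUx\|_2^2\le(1+\epsilon)\|Ux\|_2^2$ for all $x\in\mathbb{R}^r$. Constants: for $s>0$, $$c_3(r,s):=\left(\sqrt{2e\tfrac{r-1}{s}\log(2r)}+4e\tfrac{r+1}{s}\log(2r)\right)^2+2\left(\sqrt{2\tfrac{r-1}{s}\log(2r)}+\tfrac13\tfrac{r+1}{s}\log(2r)\right)+1,$$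 and, with $q=\lfloor t/2\rfloor$ and $q'=\lceil t/2\rceil$, $$c_4(r,t):=\frac{\sqrt r}{t}+\frac{t-1}{t}\bigl(c_3(r,q)\,c_3(r,q')\bigr)^{1/4}.$$ Explicitly, $M^*=C^{\dagger}A(C^{\top})^{\dagger}$ and $\widehat{M}=(SC)^{\dagger}SAS^{\top}((SC)^{\top})^{\dagger}$ (the minimizer is unique whenever $SC$ has full column rank; otherwise this minimizer is chosen). *)

(* Defs.v *)
From HB Require Import structures.
From mathcomp Require Import all_boot all_order all_algebra.
From mathcomp Require Import all_classical all_reals.
From mathcomp Require Import sequences exp.
From mathcomp Require Import spectral.
From mathcomp Require Import complex.

Set Implicit Arguments.
Unset Strict Implicit.
Unset Printing Implicit Defensive.

Import Order.TTheory GRing.Theory Num.Theory.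
Local Open Scope ring_scope.

Section Norms.
Variable R : realType.

Definition norm2 (n : nat) (x : 'cV[R]_n) : R := Num.sqrt (\sum_i x i 0 ^+ 2).

Definition frob_norm (m n : nat) (X : 'M[R]_(m, n)) : R :=
  Num.sqrt (\sum_i \sum_j X i j ^+ 2).

(* Square roots of the eigenvalues, with multiplicity, of the Gram matrix
   X^T X.  The spectral theorem of spectral.v is over a closed field, so the
   Gram matrix is read over R[i]; it is Hermitian positive semidefinite there,
   hence its eigenvalues are real and nonnegative and Re loses nothing.  For an
   m x n matrix there are n values: those in excess of min(m, n) are zero. *)
Definition singular_values (m n : nat) (X : 'M[R]_(m, n)) : 'rV[R]_n :=
  \row_i Num.sqrt (complex.Re
    (spectral_diag (map_mx (real_complex R) (X^T *m X)) 0 i)).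

Definition nuclear_norm (m n : nat) (X : 'M[R]_(m, n)) : R :=
  \sum_i singular_values X 0 i.

End Norms.

Section Pseudoinverse.
Variable R : realType.

(* mathcomp's pinvmx is only a one-sided partial inverse, not the
   Moore-Penrose pseudoinverse. *)
Definition penrose (m n : nat) (A : 'M[R]_(m, n)) (X : 'M[R]_(n, m)) : Prop :=
  [/\ A *m X *m A = A, X *m A *m X = X,
      (A *m X)^T = A *m X & (X *m A)^T = X *m A].

Definition mppinv (m n : nat) (A : 'M[R]_(m, n)) : 'M[R]_(n, m) :=
  xget 0 [set X | penrose A X]%classic.

Lemma row_free_gram_unit (k n : nat) (G : 'M[R]_(k, n)) :
  row_free G -> G *m G^T \in unitmx.
Proof.
move=> Gfree; rewrite -row_free_unit -kermx_eq0; apply/rowV0P => v.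
move/sub_kermxP; rewrite mulmxA => vGG.
have /eqP : (v *m G *m (v *m G)^T) 0 0 = 0.
  by rewrite trmx_mul mulmxA vGG mul0mx mxE.
rewrite mxE; under eq_bigr do rewrite [X in _ * X]mxE -expr2.
rewrite psumr_eq0 => [/allP z|i _]; last exact: sqr_ge0.
apply/eqP; rewrite -(mulmx_free_eq0 _ Gfree); apply/eqP/rowP => i.
rewrite [RHS]mxE; apply/eqP; rewrite -sqrf_eq0.
exact: z i (mem_index_enum i).
Qed.

Lemma penrose_exists (m n : nat) (A : 'M[R]_(m, n)) : exists X, penrose A X.
Proof.
have [k [F [G [AE FU GU]]]] : exists k (F : 'M[R]_(m, k)) (G : 'M[R]_(k, n)),
    [/\ A = F *m G, F^T *m F \in unitmx & G *m G^T \in unitmx].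
  exists (\rank A), (col_base A), (row_base A); split.
  - by rewrite mulmx_base.
  - rewrite -[X in _ *m X]trmxK; apply: row_free_gram_unit.
    by rewrite /row_free mxrank_tr -/(row_full _) col_base_full.
  - exact/row_free_gram_unit/row_base_free.
have GS : (invmx (G *m G^T))^T = invmx (G *m G^T).
  by rewrite trmx_inv trmx_mul trmxK.
have FS : (invmx (F^T *m F))^T = invmx (F^T *m F).
  by rewrite trmx_inv trmx_mul trmxK.
pose X := G^T *m invmx (G *m G^T) *m (invmx (F^T *m F) *m F^T).
have AX : A *m X = F *m (invmx (F^T *m F) *m F^T).
  by rewrite AE /X -!mulmxA (mulmxA G G^T) (mulKVmx GU).
have XA : X *m A = G^T *m invmx (G *m G^T) *m G.
  by rewrite AE /X -!mulmxA (mulmxA F^T F) (mulKmx FU).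
exists X; split.
- by rewrite AX {1}AE -!mulmxA (mulmxA F^T F) (mulKmx FU) -AE.
- by rewrite XA /X -!mulmxA (mulmxA G G^T) (mulKVmx GU).
- by rewrite AX !trmx_mul trmxK FS mulmxA.
- by rewrite XA !trmx_mul trmxK GS mulmxA.
Qed.

Lemma penrose_uniq (m n : nat) (A : 'M[R]_(m, n)) (X Y : 'M[R]_(n, m)) :
  penrose A X -> penrose A Y -> X = Y.
Proof.
move=> [AXA XAX AXs XAs] [AYA YAY AYs YAs].
have AXAY : A *m X = A *m Y.
  by rewrite -AXs -{1}AYA -(mulmxA (A *m Y)) trmx_mul AXs AYs mulmxA AXA.
have XAYA : X *m A = Y *m A.
  by rewrite -XAs -{1}AYA -(mulmxA A) mulmxA trmx_mul XAs YAs -mulmxA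
             (mulmxA A) AXA.
by rewrite -XAX -mulmxA AXAY mulmxA XAYA YAY.
Qed.

Lemma mppinvP (m n : nat) (A : 'M[R]_(m, n)) : penrose A (mppinv A).
Proof. by have [X AX] := penrose_exists A; apply: (xgetPex 0); exists X. Qed.

End Pseudoinverse.

(* C = A(:, I) with I the image of f; the enumeration of I is arbitrary. *)
Definition column_subset (R : realType) (n r : nat) (A : 'M[R]_n)
    (C : 'M[R]_(n, r)) : Prop :=
  exists2 f : 'I_r -> 'I_n, injective f & C = colsub f A.

Definition thin_svd (R : realType) (n r : nat) (C U : 'M[R]_(n, r))
    (Sigma V : 'M[R]_r) : Prop :=
  [/\ U^T *m U = 1%:M, V^T *m V = 1%:M,
      is_diag_mx Sigma, forall i, 0 <= Sigma i i & C = U *m Sigma *m V^T].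

Definition is_argmin (R : realType) (T : Type) (f : T -> R) (x : T) : Prop :=
  forall y, f x <= f y.

Definition subspace_embedding (R : realType) (n r t : nat) (eps : R)
    (S : 'M[R]_(t, n)) (U : 'M[R]_(n, r)) : Prop :=
  forall x : 'cV[R]_r,
    (1 - eps) * norm2 (U *m x) ^+ 2 <= norm2 (S *m U *m x) ^+ 2
      <= (1 + eps) * norm2 (U *m x) ^+ 2.

Section LeverageScoreSampling.
Variables (R : realType) (n r t : nat) (U : 'M[R]_(n, r)).

Definition leverage (i : 'I_n) : R := norm2 (row i U)^T ^+ 2.

Definition lss_prob (i : 'I_n) : R := leverage i / r%:R.

(* The sample space is the finite set of all t-tuples of row indices. *)
Definition lss_mx (j : {ffun 'I_t -> 'I_n}) : 'M[R]_(t, n) :=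
  \matrix_(m < t) ((Num.sqrt (t%:R * lss_prob (j m)))^-1 *: delta_mx 0 (j m)).

(* The law of t i.i.d. draws from lss_prob, i.e. its t-fold product. *)
Definition lss_Pr (E : set {ffun 'I_t -> 'I_n}) : R :=
  \sum_(j | j \in E) \prod_(m < t) lss_prob (j m).

End LeverageScoreSampling.

Section Constants.
Variable R : realType.

Definition c3 (r : nat) (s : R) : R :=
  (Num.sqrt (2 * expR 1 * ((r%:R - 1) / s) * ln (2 * r%:R))
     + 4 * expR 1 * ((r%:R + 1) / s) * ln (2 * r%:R)) ^+ 2
  + 2 * (Num.sqrt (2 * ((r%:R - 1) / s) * ln (2 * r%:R))
           + 1 / 3 * ((r%:R + 1) / s) * ln (2 * r%:R))
  + 1.

Definition c4 (r t : nat) : R :=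
  Num.sqrt r%:R / t%:R
  + (t%:R - 1) / t%:R
    * (c3 r (t./2)%:R * c3 r (uphalf t)%:R) `^ (1 / 4).

Definition c5 (r : nat) (eps Delta : R) : R :=
  Delta / ((1 - eps) ^+ 2 * Num.sqrt r%:R).

End Constants.

(* Main.v *)
Require Import Defs.
From mathcomp Require Import all_boot all_order all_algebra.
From mathcomp Require Import all_classical all_reals.
From mathcomp Require Import sequences exp.
From mathcomp Require Import spectral complex.
From mathcomp Require Import ring lra.

Set Implicit Arguments.
Unset Strict Implicit.
Unset Printing Implicit Defensive.

Import Order.TTheory GRing.Theory Num.Theory.
Local Open Scope ring_scope.

(** The theorem reduces to a first and second moment computation, because the
nuclear norm is governed by factorizations: the nuclear norm of X is the
minimum of (|P|_F^2 + |Q|_F^2) / 2 over all X = P Q^T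
([nuclear_norm_attained], [nuclear_norm_le]).

Write B = A - C M* C^T = P Q^T with an optimal factorization, D = S^T S and
G = (SU)^T (SU).  On the embedding event G is invertible and its inverse
multiplies Frobenius norms by at most 1 / (1 - eps).  The normal equations of the
sketched problem ([argmin_congruence_normal_eq]) then give
  A - C Mhat C^T = P Q^T - (U G^-1 U^T D P) (U G^-1 U^T D Q)^T,
and concatenating the two factorizations bounds the nuclear norm of the
residual by that of B plus
  (1 - eps)^-2 (|U^T D P|_F^2 + |U^T D Q|_F^2) / 2
([nuclear_norm_sketch_residual]).

For leverage score sampling the expectation of |U^T D P|_F^2 is computed
exactly from the i.i.d. second moment, and is at most
(r/t + (t-1)/t) |P|_F^2 ([lss_sketch_mean]).  Since c3 >= 1, this factor is at
most c4 sqrt r ([c4_ge]), and Markov's inequality at level Delta concludes.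
No matrix concentration is involved: all that is needed of the sample size is
t > 0, so C0 = 1 works. *)

(** * Complex matrices: singular value decomposition and Frobenius norm *)

Section ComplexSVD.
Variable C : numClosedFieldType.

(** The conjugate transpose. *)
Definition ctr (m n : nat) (X : 'M[C]_(m, n)) : 'M[C]_(n, m) :=
  map_mx Num.conj X^T.

Lemma ctrM m n p (X : 'M[C]_(m, n)) (Y : 'M[C]_(n, p)) :
  ctr (X *m Y) = ctr Y *m ctr X.
Proof. by rewrite /ctr trmx_mul map_mxM. Qed.

Lemma ctrK m n (X : 'M[C]_(m, n)) : ctr (ctr X) = X.
Proof. exact: trmxCK. Qed.

Lemma ctrB m n (X Y : 'M[C]_(m, n)) : ctr (X - Y) = ctr X - ctr Y.
Proof. by rewrite /ctr linearB map_mxB. Qed.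

Lemma tr_ctr n (X : 'M[C]_n) : \tr (ctr X) = (\tr X)^*.
Proof.
by rewrite /mxtrace rmorph_sum; apply: eq_bigr => i _; rewrite !mxE.
Qed.

Lemma ctr_diag n (d : 'rV[C]_n) :
  (forall i, 0 <= d 0 i) -> ctr (diag_mx d) = diag_mx d.
Proof.
move=> d_ge0; rewrite /ctr tr_diag_mx; apply/matrixP => i j; rewrite !mxE.
by case: eqP => [->|_]; rewrite ?mulr1n ?mulr0n ?rmorph0 ?geC0_conj.
Qed.

(** The squared Frobenius norm, as the trace of X X^*. *)
Definition cfsq (m n : nat) (X : 'M[C]_(m, n)) : C := \tr (X *m ctr X).

Lemma cfsqE m n (X : 'M[C]_(m, n)) :
  cfsq X = \sum_i \sum_j `|X i j| ^+ 2.
Proof.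
rewrite /cfsq /mxtrace; apply: eq_bigr => i _; rewrite mxE.
by apply: eq_bigr => j _; rewrite !mxE normCK.
Qed.

Lemma cfsq_ge0 m n (X : 'M[C]_(m, n)) : 0 <= cfsq X.
Proof.
by rewrite cfsqE; do 2!apply: sumr_ge0 => ? _; rewrite exprn_ge0.
Qed.

(** The arithmetic-geometric mean inequality |X - Y|_F^2 >= 0; realness of the
trace makes the two cross terms equal. *)
Lemma tr_mul_ctr_le m n (X Y : 'M[C]_(m, n)) :
  \tr (X *m ctr Y) \is Num.real ->
  2 * \tr (X *m ctr Y) <= cfsq X + cfsq Y.
Proof.
move=> /CrealP trR; have := cfsq_ge0 (X - Y).
rewrite /cfsq ctrB mulmxBl !mulmxBr !raddfB /=.
have -> : \tr (Y *m ctr X) = \tr (X *m ctr Y).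
  by rewrite -trR -tr_ctr ctrM ctrK.
move=> le0; rewrite -subr_ge0; move: le0.
by congr (0 <= _); ring.
Qed.

(** A singular value decomposition X = W diag(s) V^* whose squared singular
values are the eigenvalues of X^* X in the given order.  Columns of W with
s = 0 are zero, so W is a partial isometry rather than an isometry and no
basis extension is needed. *)
Lemma svd_exists m n (X : 'M[C]_(m, n)) :
  exists (W : 'M[C]_(m, n)) (V : 'M[C]_n) (s : 'rV[C]_n),
  [/\ forall i, 0 <= s 0 i,
      forall i, s 0 i ^+ 2 = spectral_diag (ctr X *m X) 0 i,
      V *m ctr V = 1%:M,
      X *m V = W *m diag_mx s &
      ctr W *m X *m V = diag_mx s /\
      W *m ctr W *m W = W].
Proof.
set G := ctr X *m X.
have Gn : G \is normalmx.
  by apply/normalmxP; rewrite -/(ctr G) /G ctrM ctrK.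
pose T := spectralmx G; pose V := ctr T.
have TV : T *m V = 1%:M by apply/unitarymxP/spectral_unitarymx.
have VT : V *m T = 1%:M by exact: mulmx1C.
have GE : T *m G *m V = diag_mx (spectral_diag G).
  rewrite {1}(orthomx_spectralP Gn) invmx_unitary ?spectral_unitarymx //.
  by rewrite -/T -/(ctr T) -/V !mulmxA TV mul1mx -mulmxA TV mulmx1.
have cV : ctr V = T by rewrite /V ctrK.
have colE j : spectral_diag G 0 j = \sum_i `|(X *m V) i j| ^+ 2.
  have -> : spectral_diag G 0 j = (T *m G *m V) j j.
    by rewrite GE mxE eqxx.
  rewrite /G -cV !mulmxA -ctrM -mulmxA mxE; apply: eq_bigr => k _.
  by rewrite !(mxE, normCK) mulrC.
have d_ge0 i : 0 <= spectral_diag G 0 i.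
  by rewrite colE; apply: sumr_ge0 => k _; rewrite exprn_ge0.
pose s : 'rV[C]_n := \row_i sqrtC (spectral_diag G 0 i).
have s_ge0 i : 0 <= s 0 i by rewrite mxE sqrtC_ge0.
(* s' is the entrywise pseudo-inverse of s, as the inverse of 0 is 0 *)
pose s' : 'rV[C]_n := \row_i (s 0 i)^-1.
have s'_ge0 i : 0 <= s' 0 i by rewrite mxE invr_ge0.
have sE i : s 0 i ^+ 2 = spectral_diag G 0 i by rewrite mxE sqrtCK.
have dE : diag_mx (spectral_diag G) = diag_mx s *m diag_mx s.
  rewrite mulmx_diag; congr diag_mx; apply/rowP => i.
  by rewrite [RHS]mxE -expr2 sE.
have ss's : diag_mx s *m diag_mx s' *m diag_mx s = diag_mx s.
  rewrite !mulmx_diag; congr diag_mx; apply/rowP => i.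
  rewrite 2!mxE [s' _ _]mxE; have [->|s0] := eqVneq (s 0 i) 0.
    by rewrite mulr0.
  by rewrite mulfV // mul1r.
have s'ss' : diag_mx s' *m diag_mx s *m diag_mx s' = diag_mx s'.
  rewrite !mulmx_diag; congr diag_mx; apply/rowP => i.
  rewrite 2!mxE [s' _ _]mxE; have [->|s0] := eqVneq (s 0 i) 0.
    by rewrite invr0 mulr0.
  by rewrite mulVf // mul1r.
have dC : diag_mx s' *m diag_mx s = diag_mx s *m diag_mx s'.
  exact: diag_mxC.
pose W := X *m V *m diag_mx s'.
have cW : ctr W = diag_mx s' *m T *m ctr X.
  by rewrite /W !ctrM ctr_diag // cV mulmxA.
have WXV : ctr W *m X *m V = diag_mx s.
  rewrite cW -(mulmxA _ (ctr X)) -/G -(mulmxA _ T) -(mulmxA _ (T *m G)) GE dE.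
  by rewrite mulmxA dC.
have WXVs : W *m diag_mx s = X *m V.
  (* a column of X V vanishes where its singular value does *)
  apply/matrixP => i j; rewrite /W -mulmxA mulmx_diag mul_mx_diag mxE.
  rewrite [X in _ * X]mxE [s' _ _]mxE.
  have [s0|s0] := eqVneq (s 0 j) 0; last by rewrite mulVf // mulr1.
  rewrite s0 !mulr0; apply/esym/eqP; rewrite -normr_eq0 -sqrf_eq0.
  have /eqP : \sum_i `|(X *m V) i j| ^+ 2 = 0 by rewrite -colE -sE s0 expr0n.
  rewrite psumr_eq0 => [/allP z|k _]; last by rewrite exprn_ge0.
  exact: z i (mem_index_enum i).
exists W, V, s; split=> //; first by rewrite cV.
split=> //.
by rewrite {3}/W 2!mulmxA -(mulmxA W) -(mulmxA W) WXV WXVs.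
Qed.
(** W W^* is an orthogonal projector H, and |X|_F^2 - |W^* X|_F^2 is
|X - H X|_F^2. *)
Lemma cfsq_partial_isometry_le m n k (W : 'M[C]_(m, n)) (X : 'M[C]_(m, k)) :
  W *m ctr W *m W = W -> cfsq (ctr W *m X) <= cfsq X.
Proof.
move=> WWW; pose H := W *m ctr W; pose XX := X *m ctr X.
have HH : H *m H = H by rewrite {2}/H mulmxA WWW.
have cH : ctr H = H by rewrite /H ctrM ctrK.
have -> : cfsq (ctr W *m X) = \tr (H *m XX).
  rewrite /cfsq ctrM ctrK -mulmxA mxtrace_mulC [RHS]mxtrace_mulC.
  by rewrite /H /XX !mulmxA.
have := cfsq_ge0 (X - H *m X).
rewrite {1}/cfsq ctrB ctrM cH mulmxBl !mulmxBr !raddfB /=.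
rewrite mulmxA -!(mulmxA H) (mulmxA X) -/XX.
rewrite [\tr (XX *m H)]mxtrace_mulC [\tr (H *m (XX *m H))]mxtrace_mulC.
rewrite -(mulmxA XX) HH [\tr (XX *m H)]mxtrace_mulC addrN addr0.
by rewrite subr_ge0.
Qed.

Lemma cfsq_coisometry m n k (V : 'M[C]_(m, n)) (X : 'M[C]_(m, k)) :
  V *m ctr V = 1%:M -> cfsq (ctr V *m X) = cfsq X.
Proof.
move=> VV; rewrite /cfsq ctrM ctrK mxtrace_mulC.
by rewrite !mulmxA -(mulmxA _ V) VV mulmx1 mxtrace_mulC.
Qed.

End ComplexSVD.

(** * Nuclear norm and factorizations of real matrices *)

Section NuclearNorm.
Variable R : realType.

Local Notation toC := (map_mx (real_complex R)).

(** The squared Frobenius norm of a real matrix. *)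
Definition fsq (m n : nat) (X : 'M[R]_(m, n)) : R := \sum_i \sum_j X i j ^+ 2.

Lemma fsq_ge0 m n (X : 'M[R]_(m, n)) : 0 <= fsq X.
Proof. by do 2!apply: sumr_ge0 => ? _; rewrite sqr_ge0. Qed.

Lemma fsq_trE m n (X : 'M[R]_(m, n)) : fsq X = \tr (X *m X^T).
Proof.
apply: eq_bigr => i _; rewrite mxE; apply: eq_bigr => j _.
by rewrite mxE expr2.
Qed.

Lemma fsq_tr m n (X : 'M[R]_(m, n)) : fsq X^T = fsq X.
Proof. by rewrite !fsq_trE trmxK mxtrace_mulC. Qed.

Lemma fsqN m n (X : 'M[R]_(m, n)) : fsq (- X) = fsq X.
Proof.
by apply: eq_bigr => i _; apply: eq_bigr => j _; rewrite mxE sqrrN.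
Qed.

Lemma fsq0 m n : fsq (0 : 'M[R]_(m, n)) = 0.
Proof. by rewrite fsq_trE mul0mx mxtrace0. Qed.

Lemma fsq_row_mx m n1 n2 (X : 'M[R]_(m, n1)) (Y : 'M[R]_(m, n2)) :
  fsq (row_mx X Y) = fsq X + fsq Y.
Proof. by rewrite !fsq_trE tr_row_mx mul_row_col raddfD. Qed.

Lemma fsq_eq0 m n (X : 'M[R]_(m, n)) : fsq X = 0 -> X = 0.
Proof.
move=> /eqP; rewrite psumr_eq0; last first.
  by move=> i _; apply: sumr_ge0 => j _; rewrite sqr_ge0.
move=> /allP X0; apply/matrixP => i j; rewrite mxE.
have /= := X0 i (mem_index_enum i); rewrite psumr_eq0; last first.
  by move=> k _; rewrite sqr_ge0.
by move=> /allP /(_ j (mem_index_enum j)) /=; rewrite sqrf_eq0 => /eqP.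
Qed.

Lemma fsq_affine m n (X Y : 'M[R]_(m, n)) (s : R) :
  fsq (X - s *: Y) = fsq X - 2 * s * \tr (X^T *m Y) + s ^+ 2 * fsq Y.
Proof.
have -> : \tr (X^T *m Y) = \sum_i \sum_j X i j * Y i j.
  rewrite exchange_big; apply: eq_bigr => i _; rewrite mxE.
  by apply: eq_bigr => j _; rewrite mxE.
rewrite /fsq !mulr_sumr -sumrB -big_split; apply: eq_bigr => i _ /=.
rewrite !mulr_sumr -sumrB -big_split; apply: eq_bigr => j _ /=.
by rewrite !mxE; ring.
Qed.

Lemma fsq_isometry n r k (U : 'M[R]_(n, r)) (X : 'M[R]_(r, k)) :
  U^T *m U = 1%:M -> fsq (U *m X) = fsq X.
Proof.
move=> UU; rewrite -fsq_tr fsq_trE trmxK trmx_mul -!mulmxA (mulmxA U^T U) UU.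
by rewrite mul1mx -[RHS]fsq_tr fsq_trE trmxK.
Qed.

Lemma fsq_col m n (X : 'M[R]_(m, n)) : fsq X = \sum_k fsq (col k X).
Proof.
rewrite /fsq exchange_big; apply: eq_bigr => k _; apply: eq_bigr => i _.
by rewrite big_ord1 mxE.
Qed.

Lemma norm2_sqr n (x : 'cV[R]_n) : norm2 x ^+ 2 = fsq x.
Proof.
rewrite sqr_sqrtr; last by apply: sumr_ge0 => i _; rewrite sqr_ge0.
by apply: eq_bigr => i _; rewrite big_ord1.
Qed.

(** Coordinates of P in an orthonormal family: |P - U U^T P|_F^2 >= 0. *)
Lemma fsq_orthonormal_le n r k (U : 'M[R]_(n, r)) (P : 'M[R]_(n, k)) :
  U^T *m U = 1%:M -> fsq (U^T *m P) <= fsq P.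
Proof.
move=> UU; have := fsq_ge0 (P - 1 *: (U *m (U^T *m P))).
rewrite fsq_affine (fsq_isometry _ UU).
have -> : \tr (P^T *m (U *m (U^T *m P))) = fsq (U^T *m P).
  by rewrite -[in RHS]fsq_tr fsq_trE trmxK trmx_mul trmxK !mulmxA.
by move=> ?; lra.
Qed.

Lemma ctr_toC m n (X : 'M[R]_(m, n)) : ctr (toC X) = toC X^T.
Proof.
apply/matrixP => i j; rewrite !mxE; apply: conj_Creal.
by apply/complex_realP; exists (X j i).
Qed.

Lemma cfsq_toC m n (X : 'M[R]_(m, n)) : cfsq (toC X) = (fsq X)%:C%C.
Proof. by rewrite /cfsq ctr_toC -map_mxM fsq_trE trace_map_mx. Qed.

(** The decomposition of [svd_exists] for a real X read over the complex
numbers; its singular values sum to the nuclear norm. *)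
Lemma nuclear_norm_svd m n (X : 'M[R]_(m, n)) :
  exists (W : 'M[R[i]]_(m, n)) (V : 'M[R[i]]_n) (s : 'rV[R[i]]_n),
  [/\ forall i, 0 <= s 0 i,
      (nuclear_norm X)%:C%C = \tr (diag_mx s),
      V *m ctr V = 1%:M,
      toC X *m V = W *m diag_mx s &
      ctr W *m toC X *m V = diag_mx s /\
      W *m ctr W *m W = W].
Proof.
have [W [V [s [s_ge0 sE VV XV WX]]]] := svd_exists (toC X).
exists W, V, s; split=> //.
rewrite mxtrace_diag /nuclear_norm raddf_sum; apply: eq_bigr => i _ /=.
rewrite mxE map_mxM -ctr_toC -sE.
have sR : s 0 i = (complex.Re (s 0 i))%:C%C by rewrite RRe_real // ger0_real.
rewrite sR -rmorphXn /= sqrtr_sqr ger0_norm //.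
by rewrite -lecR -sR.
Qed.

(** With the decomposition W diag(s) V^* of P Q^T, the nuclear norm is
tr(W^* P Q^T V), a Frobenius inner product of W^* P and V^* Q. *)
Lemma nuclear_norm_le m n k (P : 'M[R]_(m, k)) (Q : 'M[R]_(n, k)) :
  2 * nuclear_norm (P *m Q^T) <= fsq P + fsq Q.
Proof.
have [W [V [s [s_ge0 nE VV _ [WXV WWW]]]]] := nuclear_norm_svd (P *m Q^T).
pose P' := ctr W *m toC P; pose Q' := ctr V *m toC Q.
have trE : (nuclear_norm (P *m Q^T))%:C%C = \tr (P' *m ctr Q').
  by rewrite nE -WXV map_mxM -ctr_toC /Q' ctrM ctrK /P' !mulmxA.
have P'le : cfsq P' <= cfsq (toC P) := cfsq_partial_isometry_le _ WWW.
have Q'E : cfsq Q' = cfsq (toC Q) := cfsq_coisometry _ VV.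
have := @tr_mul_ctr_le _ _ _ P' Q'.
rewrite -trE => /(_ _) le2.
rewrite -lecR.
have -> : (2 * nuclear_norm (P *m Q^T))%:C%C
    = 2 * (nuclear_norm (P *m Q^T))%:C%C by rewrite rmorphM rmorph_nat.
have -> : (fsq P + fsq Q)%:C%C = cfsq (toC P) + cfsq Q'.
  by rewrite rmorphD Q'E !cfsq_toC.
apply: le_trans (le2 _) _; last by rewrite lerD2r.
by apply/complex_realP; eexists.
Qed.

(** Splitting W diag(s) V^* evenly gives complex factors W diag(s)^(1/2) and
V diag(s)^(1/2). *)
Lemma nuclear_norm_attained m n (X : 'M[R]_(m, n)) :
  exists k (P : 'M[R]_(m, k)) (Q : 'M[R]_(n, k)),
    X = P *m Q^T /\ fsq P + fsq Q = 2 * nuclear_norm X.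
Proof.
have [W [V [s [s_ge0 nE VV XV [WXV _]]]]] := nuclear_norm_svd X.
pose q : 'rV[R[i]]_n := \row_i sqrtC (s 0 i).
have q_ge0 i : 0 <= q 0 i by rewrite mxE sqrtC_ge0.
have qq : diag_mx q *m diag_mx q = diag_mx s.
  rewrite mulmx_diag; congr diag_mx; apply/rowP => i.
  by rewrite !mxE -expr2 sqrtCK.
pose P := W *m diag_mx q; pose Q := V *m diag_mx q.
have PQ : toC X = P *m ctr Q.
  rewrite /P /Q ctrM ctr_diag // !mulmxA -(mulmxA W) qq -XV.
  by rewrite -mulmxA VV mulmx1.
have PE : cfsq P = (nuclear_norm X)%:C%C.
  rewrite /cfsq /P ctrM ctr_diag // !mulmxA -(mulmxA W) qq -XV.
  by rewrite mxtrace_mulC mulmxA WXV nE.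
have QE : cfsq Q = (nuclear_norm X)%:C%C.
  rewrite /cfsq /Q ctrM ctr_diag // !mulmxA -(mulmxA V) qq mxtrace_mulC.
  by rewrite mulmxA (mulmx1C VV) mul1mx nE.
clearbody P Q.
(* the real part Re P (Re Q)^T + Im P (Im Q)^T of P Q^* turns
   complex factors into real ones with the same Frobenius norms *)
pose ReIm p (Z : 'M[R[i]]_(p, n)) : 'M[R]_(p, n + n) :=
  row_mx (map_mx (@complex.Re R) Z) (map_mx (@complex.Im R) Z).
have ReImE p (Z : 'M[R[i]]_(p, n)) : (fsq (ReIm p Z))%:C%C = cfsq Z.
  rewrite cfsqE fsq_row_mx /fsq -big_split rmorph_sum; apply: eq_bigr => i _.
  rewrite -big_split rmorph_sum; apply: eq_bigr => j _ /=.
  by rewrite !mxE add_Re2_Im2.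
exists (n + n)%N, (ReIm m P), (ReIm n Q); split.
  rewrite /ReIm tr_row_mx mul_row_col; apply/matrixP => i j.
  have /(congr1 (@complex.Re R)) : (toC X) i j = (P *m ctr Q) i j by rewrite PQ.
  rewrite mxE /= => ->; rewrite !mxE -big_split /=.
  rewrite (raddf_sum (@complex.Re R : Rcomplex R -> R)).
  apply: eq_bigr => k _; rewrite !mxE.
  by case: (P i k) => a b; case: (Q j k) => c d /=; ring.
have -> : fsq (ReIm m P) = nuclear_norm X by apply: complexI; rewrite ReImE.
have -> : fsq (ReIm n Q) = nuclear_norm X by apply: complexI; rewrite ReImE.
by rewrite mulrDl mul1r.
Qed.

End NuclearNorm.

(** * The sketched least squares problem *)

Section LeastSquares.
Variable R : realType.

(** The gradient of |Y - F M F^T|_F^2 vanishes at a minimizer, tested in the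
direction H = F^T (Y - F M F^T) F. *)
Lemma argmin_congruence_normal_eq t r (F : 'M[R]_(t, r)) (Y : 'M[R]_t)
    (M : 'M[R]_r) :
  is_argmin (fun M : 'M[R]_r => frob_norm (Y - F *m M *m F^T)) M ->
  F^T *m (Y - F *m M *m F^T) *m F = 0.
Proof.
move=> Mmin; set E := Y - _; set H := _ *m F.
pose K := fsq (F *m H *m F^T).
have K_ge0 : 0 <= K by apply: fsq_ge0.
have le_s s : 2 * s * fsq H <= s ^+ 2 * K.
  have := Mmin (M + s *: H); rewrite /frob_norm ler_sqrt ?fsq_ge0 //.
  rewrite -/(fsq _) -/E -/(fsq _) mulmxDr mulmxDl opprD addrA -/E.
  rewrite -scalemxAr -scalemxAl fsq_affine -/K.
  have -> : \tr (E^T *m (F *m H *m F^T)) = fsq H.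
    rewrite mulmxA mxtrace_mulC -[RHS]fsq_tr fsq_trE trmxK.
    by rewrite {2}/H !trmx_mul trmxK !mulmxA.
  by move=> ?; lra.
(* this step makes -2 s |H|_F^2 + s^2 K negative unless H = 0;
   the + 1 covers K = 0 *)
pose s := fsq H / (K + 1).
have K1 : K + 1 != 0 by rewrite gt_eqF // ltr_wpDl.
have hE : fsq H = s * (K + 1) by rewrite /s divfK.
have s2 : s ^+ 2 = 0.
  have := le_s s; rewrite {1}hE => le1.
  have s2_ge0 : 0 <= s ^+ 2 by rewrite sqr_ge0.
  have s2K : 0 <= s ^+ 2 * K by rewrite mulr_ge0.
  apply/eqP; rewrite eq_le s2_ge0 andbT.
  have -> : s ^+ 2 = (2 * s * (s * (K + 1)) - 2 * (s ^+ 2 * K)) / 2 by field.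
  lra.
apply: fsq_eq0; rewrite hE; move/eqP: s2; rewrite sqrf_eq0 => /eqP ->.
by rewrite mul0r.
Qed.

Lemma fsq_embedding n r t eps (S : 'M[R]_(t, n)) (U : 'M[R]_(n, r)) k
    (Y : 'M[R]_(r, k)) :
  U^T *m U = 1%:M -> subspace_embedding eps S U ->
  (1 - eps) * fsq Y <= fsq (S *m U *m Y).
Proof.
move=> UU emb; rewrite !fsq_col mulr_sumr; apply: ler_sum => j _.
have /andP[+ _] := emb (col j Y).
by rewrite !norm2_sqr fsq_isometry // !colE mulmxA.
Qed.

(** A quadratic form bound c |Y|^2 <= <Y, G Y> for G = W^T W gives
c |Y| <= |G Y|, by expanding |G Y - c Y|_F^2 >= 0. *)
Lemma fsq_gram_ge r t k c (W : 'M[R]_(t, r)) (Y : 'M[R]_(r, k)) :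
  0 <= c -> c * fsq Y <= fsq (W *m Y) ->
  c ^+ 2 * fsq Y <= fsq (W^T *m W *m Y).
Proof.
move=> c_ge0 le1; have := fsq_ge0 (W^T *m W *m Y - c *: Y).
rewrite fsq_affine.
have -> : \tr ((W^T *m W *m Y)^T *m Y) = fsq (W *m Y).
  by rewrite -fsq_tr fsq_trE trmxK !trmx_mul trmxK !mulmxA.
have := ler_wpM2l c_ge0 le1.
by rewrite mulrA -expr2 => ? ?; lra.
Qed.

Lemma gram_unit r t c (W : 'M[R]_(t, r)) :
  0 < c -> (forall Y : 'cV[R]_r, c * fsq Y <= fsq (W *m Y)) ->
  W^T *m W \in unitmx.
Proof.
move=> c_gt0 lb; rewrite -{2}[W]trmxK; apply: row_free_gram_unit.
rewrite -kermx_eq0; apply/rowV0P => v /sub_kermxP vW.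
have := lb v^T; have -> : W *m v^T = 0.
  by rewrite -[W]trmxK -trmx_mul vW trmx0.
rewrite fsq0 pmulr_rle0 // => v0; apply: fsq_eq0; apply/eqP.
by rewrite -fsq_tr eq_le v0 fsq_ge0.
Qed.

(** The hypothesis on K is the normal equation of the sketched problem; it
forces K = G^-1 (W^T S P) (W^T S Q)^T G^-1, so the residual P Q^T - U K U^T is
a product of two concatenated factors. *)
Lemma nuclear_norm_sketch_residual n r t k c (U : 'M[R]_(n, r))
    (S : 'M[R]_(t, n)) (K : 'M[R]_r) (P Q : 'M[R]_(n, k)) :
  let W := S *m U in
  U^T *m U = 1%:M -> 0 < c ->
  (forall l (Y : 'M[R]_(r, l)), c * fsq Y <= fsq (W *m Y)) ->
  W^T *m (S *m (P *m Q^T - U *m K *m U^T) *m S^T) *m W = 0 ->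
  2 * nuclear_norm (P *m Q^T - U *m K *m U^T)
    <= fsq P + fsq Q
       + (fsq (W^T *m (S *m P)) + fsq (W^T *m (S *m Q))) / c ^+ 2.
Proof.
move=> W UU c_gt0 lb neq.
set L := W^T *m (S *m P); set N := W^T *m (S *m Q).
pose G := W^T *m W.
have Gu : G \in unitmx by apply: gram_unit c_gt0 _ => Y; apply: lb.
have GT : (invmx G)^T = invmx G by rewrite trmx_inv trmx_mul trmxK.
have GKG : G *m K *m G = L *m N^T.
  apply/esym/eqP; rewrite -subr_eq0 -[X in _ == X]neq; apply/eqP.
  rewrite mulmxBr mulmxBl mulmxBr mulmxBl /L /N /G /W.
  by rewrite !trmx_mul !trmxK !mulmxA.
have KE : K = invmx G *m L *m (invmx G *m N)^T.
  rewrite trmx_mul GT mulmxA -(mulmxA _ L) -GKG -(mulmxA G).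
  by rewrite mulKmx // mulmxK.
have bound (Z : 'M[R]_(r, k)) :
    fsq (U *m (invmx G *m Z)) <= fsq Z / c ^+ 2.
  rewrite fsq_isometry // ler_pdivlMr ?exprn_gt0 // mulrC.
  have := fsq_gram_ge (ltW c_gt0) (lb k (invmx G *m Z)).
  by rewrite -/G mulKVmx.
have -> : P *m Q^T - U *m K *m U^T
    = row_mx P (- (U *m (invmx G *m L))) *m (row_mx Q (U *m (invmx G *m N)))^T.
  rewrite tr_row_mx mul_row_col mulNmx {1}KE.
  by rewrite [(U *m (invmx G *m N))^T]trmx_mul !mulmxA.
apply: le_trans (nuclear_norm_le _ _) _.
rewrite !fsq_row_mx fsqN.
by have := bound L; have := bound N; lra.
Qed.

End LeastSquares.

(** * Moments of sums of independent draws *)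

Section IidSums.
Variables (R : realType) (I : finType) (t : nat) (p : I -> R).
Hypothesis p_sum1 : \sum_i p i = 1.

Local Notation wt j := (\prod_(m < t) p (j m)).

(** The mean of z(j_m1) z(j_m2): the draws are independent unless they have
the same index. *)
Lemma iid_cross (z : I -> R) (m1 m2 : 'I_t) :
  \sum_(j : {ffun 'I_t -> I}) wt j * (z (j m1) * z (j m2)) =
  if m1 == m2 then \sum_i p i * z i ^+ 2 else (\sum_i p i * z i) ^+ 2.
Proof.
(* the summand factors over the draws, so sum and product can be exchanged *)
pose F k i :=
  p i * ((if k == m1 then z i else 1) * (if k == m2 then z i else 1)).
transitivity (\sum_(j : {ffun 'I_t -> I}) \prod_(m < t) F m (j m)).
  apply: eq_bigr => j _; rewrite /F !big_split /=.
  by rewrite -!big_mkcond !big_pred1_eq.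
rewrite -bigA_distr_bigA /=; case: (eqVneq m1 m2) => [m12|m12].
  rewrite (bigD1 m1) //= [X in _ * X]big1 ?mulr1 => [|k /negPf km].
    by apply: eq_bigr => i _; rewrite /F -m12 eqxx expr2.
  by rewrite -p_sum1; apply: eq_bigr => i _; rewrite /F -m12 km !mulr1.
rewrite (bigD1 m1) // (bigD1 m2) /=; last by rewrite eq_sym.
rewrite [X in _ * (_ * X)]big1 ?mulr1 => [|k /andP[/negPf km1 /negPf km2]].
  rewrite expr2; congr (_ * _); apply: eq_bigr => i _; rewrite /F eqxx.
    by rewrite (negPf m12) mulr1.
  by rewrite eq_sym (negPf m12) mul1r.
by rewrite -p_sum1; apply: eq_bigr => i _; rewrite /F km1 km2 !mulr1.
Qed.

Lemma iid_second_moment (z : I -> R) :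
  \sum_(j : {ffun 'I_t -> I}) wt j * (\sum_(m < t) z (j m)) ^+ 2 =
  t%:R * (\sum_i p i * z i ^+ 2)
  + t%:R * (t%:R - 1) * (\sum_i p i * z i) ^+ 2.
Proof.
pose a := \sum_i p i * z i ^+ 2; pose b := (\sum_i p i * z i) ^+ 2.
rewrite -/a -/b.
transitivity (\sum_(m1 < t) \sum_(m2 < t) if m1 == m2 then a else b).
  under [RHS]eq_bigr do under eq_bigr do rewrite /a /b -iid_cross.
  under [RHS]eq_bigr do rewrite exchange_big.
  rewrite [RHS]exchange_big; apply: eq_bigr => j _.
  rewrite expr2 mulr_suml mulr_sumr; apply: eq_bigr => m1 _.
  by rewrite mulr_sumr mulr_sumr.
have rowE (m1 : 'I_t) :
    \sum_(m2 < t) (if m1 == m2 then a else b) = b * t%:R + (a - b).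
  transitivity (\sum_(m2 < t) (b + if m2 == m1 then a - b else 0)).
    apply: eq_bigr => m2 _; rewrite eq_sym; case: eqP => _; first by ring.
    by rewrite addr0.
  rewrite big_split /= -big_mkcond big_pred1_eq sumr_const card_ord.
  by rewrite mulr_natr.
under eq_bigr do rewrite rowE.
by rewrite sumr_const card_ord -[LHS]mulr_natr; ring.
Qed.

End IidSums.

(** * Leverage score sampling *)

Section Sampling.
Variables (R : realType) (n r : nat) (U : 'M[R]_(n, r)).
Hypotheses (r_gt0 : (0 < r)%N) (UU : U^T *m U = 1%:M).

Local Notation p := (lss_prob U).

Let r_neq0 : r%:R != 0 :> R. Proof. by rewrite pnatr_eq0 -lt0n. Qed.

Lemma leverageE i : leverage U i = \sum_a U i a ^+ 2.
Proof.
rewrite /leverage norm2_sqr; apply: eq_bigr => a _.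
by rewrite big_ord1 !mxE.
Qed.

Lemma lss_prob_ge0 i : 0 <= p i.
Proof. by rewrite divr_ge0 ?ler0n ?sqr_ge0. Qed.

Lemma lss_prob_sum1 : \sum_i p i = 1.
Proof.
rewrite -mulr_suml; under eq_bigr do rewrite leverageE.
by rewrite -/(fsq U) -fsq_tr fsq_trE trmxK UU mxtrace1 divff.
Qed.

(** Rows that are never drawn are zero rows of U, so the inverse weights 1/0 = 0
lose nothing. *)
Lemma lss_prob_eq0 i a : p i = 0 -> U i a = 0.
Proof.
move=> /eqP; rewrite mulf_eq0 invr_eq0 (negPf r_neq0) orbF leverageE.
rewrite psumr_eq0 => [/allP U0|b _]; last by rewrite sqr_ge0.
by apply/eqP; rewrite -sqrf_eq0; apply: U0 (mem_index_enum a).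
Qed.

Variable t : nat.
Hypothesis t_gt0 : (0 < t)%N.
Let t_neq0 : t%:R != 0 :> R. Proof. by rewrite pnatr_eq0 -lt0n. Qed.

Lemma lss_mulE k (X : 'M[R]_(n, k)) (j : {ffun 'I_t -> 'I_n}) m b :
  (lss_mx U j *m X) m b = (Num.sqrt (t%:R * p (j m)))^-1 * X (j m) b.
Proof.
rewrite mxE (bigD1 (j m)) //= big1 ?addr0 => [|i /negPf ij].
  by rewrite !mxE !eqxx mulr1.
by rewrite !mxE ij andbF mulr0 mul0r.
Qed.

Lemma lss_sketchE k (X : 'M[R]_(n, k)) (j : {ffun 'I_t -> 'I_n}) a b :
  ((lss_mx U j *m U)^T *m (lss_mx U j *m X)) a b =
  \sum_(m < t) (t%:R * p (j m))^-1 * (U (j m) a * X (j m) b).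
Proof.
rewrite mxE; apply: eq_bigr => m _; rewrite mxE !lss_mulE mulrACA.
by rewrite -invfM -expr2 sqr_sqrtr // mulr_ge0 ?ler0n ?lss_prob_ge0.
Qed.

(** The expectation of |U^T S^T S X|_F^2. *)
Lemma lss_sketch_mean k (X : 'M[R]_(n, k)) :
  \sum_(j : {ffun 'I_t -> 'I_n}) (\prod_(m < t) p (j m)) *
      fsq ((lss_mx U j *m U)^T *m (lss_mx U j *m X))
    <= (r%:R / t%:R + (t%:R - 1) / t%:R) * fsq X.
Proof.
pose z a b i := (t%:R * p i)^-1 * (U i a * X i b).
have pz a b i : p i * z a b i = t%:R^-1 * (U i a * X i b).
  rewrite /z; have [p0|p0] := eqVneq (p i) 0.
    by rewrite (lss_prob_eq0 a p0) p0 !mul0r mulr0.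
  by rewrite invfM; field; rewrite p0 t_neq0.
have lev_le i : (t%:R * p i)^-1 * leverage U i <= r%:R / t%:R.
  have -> : leverage U i = r%:R * p i by rewrite mulrC divfK.
  have [->|p0] := eqVneq (p i) 0; first by rewrite !mulr0 divr_ge0 ?ler0n.
  by rewrite le_eqVlt; apply/orP; left; apply/eqP; field; rewrite p0 t_neq0.
have wE a b : \sum_(j : {ffun 'I_t -> 'I_n}) (\prod_(m < t) p (j m)) *
      (\sum_(m < t) z a b (j m)) ^+ 2
    = (\sum_i (t%:R * p i)^-1 * (U i a ^+ 2 * X i b ^+ 2))
      + (t%:R - 1) / t%:R * (U^T *m X) a b ^+ 2.
  rewrite (iid_second_moment t lss_prob_sum1); congr (_ + _).
    rewrite mulr_sumr; apply: eq_bigr => i _.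
    rewrite expr2 [p i * _]mulrA pz -!mulrA mulVKf //.
    rewrite /z; set q := (_ * p i)^-1; ring.
  under eq_bigr do rewrite pz.
  rewrite -mulr_sumr; have -> : (U^T *m X) a b = \sum_i U i a * X i b.
    by rewrite mxE; apply: eq_bigr => i _; rewrite mxE.
  by field.
have -> : \sum_(j : {ffun 'I_t -> 'I_n}) (\prod_(m < t) p (j m)) *
      fsq ((lss_mx U j *m U)^T *m (lss_mx U j *m X))
    = (\sum_i (t%:R * p i)^-1 * leverage U i * \sum_b X i b ^+ 2)
      + (t%:R - 1) / t%:R * fsq (U^T *m X).
  under eq_bigr => j _.
    rewrite /fsq mulr_sumr; under eq_bigr do rewrite mulr_sumr.
    under eq_bigr do under eq_bigr do rewrite lss_sketchE.
    over.
  rewrite exchange_big /=; under eq_bigr do rewrite exchange_big /=.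
  under eq_bigr do under eq_bigr do rewrite wE.
  under eq_bigr do rewrite big_split /=.
  rewrite big_split /=; congr (_ + _); last first.
    by rewrite /fsq mulr_sumr; apply: eq_bigr => a _; rewrite mulr_sumr.
  under eq_bigr do rewrite exchange_big /=.
  rewrite exchange_big; apply: eq_bigr => i _ /=.
  rewrite leverageE [_^-1 * _]mulr_sumr mulr_suml; apply: eq_bigr => a _.
  by rewrite mulr_sumr; apply: eq_bigr => b _; rewrite mulrA.
rewrite [leRHS]mulrDl lerD //.
  rewrite mulr_sumr; apply: ler_sum => i _; apply: ler_wpM2r => //.
  by apply: sumr_ge0 => b _; rewrite sqr_ge0.
apply: ler_wpM2l; last exact: fsq_orthonormal_le.
by rewrite divr_ge0 ?ler0n // subr_ge0 ler1n.
Qed.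
End Sampling.

(** * The constants, Markov's inequality and the conclusion *)

Section Constants.
Variable R : realType.

Lemma ln_2r_ge0 r : (0 < r)%N -> 0 <= ln (2 * r%:R) :> R.
Proof.
move=> r_gt0; apply: ln_ge0.
have : 1 <= r%:R :> R by rewrite ler1n.
lra.
Qed.

Lemma c3_ge1 r (s : R) : (0 < r)%N -> 0 <= s -> 1 <= c3 r s.
Proof.
move=> r_gt0 s_ge0; rewrite /c3 lerDr addr_ge0 ?sqr_ge0 //.
rewrite mulr_ge0 // addr_ge0 ?sqrtr_ge0 //.
rewrite !mulr_ge0 ?ln_2r_ge0 ?invr_ge0 //.
by rewrite addr_ge0.
Qed.

Lemma c4_ge r t : (0 < r)%N -> (0 < t)%N ->
  r%:R / t%:R + (t%:R - 1) / t%:R <= c4 R r t * Num.sqrt r%:R.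
Proof.
move=> r_gt0 t_gt0; rewrite /c4 [leRHS]mulrDl; apply: lerD.
  by rewrite mulrAC -expr2 sqr_sqrtr // ler0n.
have t1 : 0 <= (t%:R - 1) / t%:R :> R.
  by rewrite divr_ge0 ?ler0n // subr_ge0 ler1n.
rewrite -[leRHS]mulrA; apply: ler_peMr => //; apply: mulr_ege1; last first.
  by rewrite -[leLHS]sqrtr1 ler_sqrt ?ler0n ?ler1n.
set c := _ * _; have c1 : 1 <= c by rewrite mulr_ege1 ?c3_ge1 ?ler0n.
by rewrite -[X in X <= _](powRr0 c) ler_powR // divr_ge0.
Qed.

End Constants.

(** Markov's inequality for the nonnegative function Y, without requiring the
weights w to sum to 1. *)
Lemma markov_finite (R : realType) (T : finType) (w Y : T -> R) (k b D : R) :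
  (forall j, 0 <= w j) -> (forall j, 0 <= Y j) -> 0 < D -> 0 < b ->
  \sum_j w j * Y j <= k * b ->
  \sum_(j | D * b < Y j) w j <= k / D.
Proof.
move=> w_ge0 Y_ge0 D_gt0 b_gt0 mean.
rewrite ler_pdivlMr // -(ler_pM2r b_gt0) -mulrA.
apply: le_trans mean; rewrite mulr_suml big_mkcond /=.
apply: ler_sum => j _; case: ifP => [/ltW DY|_]; last exact: mulr_ge0.
exact: ler_wpM2l.
Qed.

Theorem theorem4p9 (R : realType) :
  exists C0 : R, 0 < C0 /\
  forall (n r t : nat) (A : 'M[R]_n) (C U : 'M[R]_(n, r)) (Sigma V : 'M[R]_r)
    (eps delta : R) (Mstar : 'M[R]_r)
    (Mhat : {ffun 'I_t -> 'I_n} -> 'M[R]_r),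
  (0 < r)%N -> (r <= n)%N ->
  A^T = A ->
  column_subset A C ->
  \rank C = r ->
  thin_svd C U Sigma V ->
  C0 * r%:R * ln (2 * r%:R) <= t%:R ->
  0 < eps < 1 ->
  0 <= delta ->
  1 - delta
    <= lss_Pr U [set j : {ffun 'I_t -> 'I_n}
                   | subspace_embedding eps (lss_mx U j) U]%classic ->
  is_argmin (fun M : 'M[R]_r => frob_norm (A - C *m M *m C^T)) Mstar ->
  (forall j : {ffun 'I_t -> 'I_n}, let S := lss_mx U j in
     is_argmin
       (fun M : 'M[R]_r => frob_norm (S *m (A - C *m M *m C^T) *m S^T))
       (Mhat j)
     /\ (\rank (S *m C) <> r ->
         Mhat j = mppinv (S *m C) *m (S *m A *m S^T) *m mppinv (S *m C)^T)) ->
  forall Delta : R, c4 R r t * Num.sqrt r%:R < Delta ->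
  1 - (c4 R r t * Num.sqrt r%:R / Delta + delta)
    <= lss_Pr U [set j : {ffun 'I_t -> 'I_n}
         | nuclear_norm (A - C *m Mhat j *m C^T)
             <= (1 + c5 r eps Delta * Num.sqrt r%:R)
                * nuclear_norm (A - C *m Mstar *m C^T)]%classic.
Proof.
exists 1; split=> // n r t A C U Sigma V eps delta Mstar Mhat r_gt0 _ _ _ rkC.
move=> [UU VV _ _ CE] t_ge /andP[_ eps_lt1] _ emb _ Mhat_min Delta Delta_gt.
have r1 : 1 <= r%:R :> R by rewrite ler1n.
have t_gt0 : (0 < t)%N.
  rewrite -(ltr0n R); apply: lt_le_trans t_ge.
  rewrite mul1r mulr_gt0 ?ln_gt0 ?ltr0n //; lra.
set kappa := c4 R r t * _ in Delta_gt *.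
have kappa_ge : r%:R / t%:R + (t%:R - 1) / t%:R <= kappa by apply: c4_ge.
have kappa_ge0 : 0 <= kappa.
  apply: le_trans kappa_ge; apply: addr_ge0; first by rewrite divr_ge0.
  by rewrite divr_ge0 // subr_ge0 ler1n.
have Delta_gt0 : 0 < Delta by apply: le_lt_trans Delta_gt.
pose c := 1 - eps; have c_gt0 : 0 < c by rewrite subr_gt0.
have -> : c5 r eps Delta * Num.sqrt r%:R = Delta / c ^+ 2.
  rewrite /c5 -/c; field; rewrite gt_eqF //= gt_eqF // sqrtr_gt0.
  exact: lt_le_trans r1.
set B := A - C *m Mstar *m C^T.
have [k [P [Q [BE PQ]]]] := nuclear_norm_attained B.
(* C = U T with T invertible, so the minimizers correspond through T *)
pose T := Sigma *m V^T.
have {}CE : C = U *m T by rewrite /T mulmxA.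
have Tu : T \in unitmx.
  by rewrite -row_free_unit -row_leq_rank -[leqLHS]rkC CE mxrankM_maxr.
pose L (j : {ffun 'I_t -> 'I_n}) (X : 'M[R]_(n, k)) :=
  fsq ((lss_mx U j *m U)^T *m (lss_mx U j *m X)).
pose Y j := L j P + L j Q.
pose b := 2 * nuclear_norm B.
pose w (j : {ffun 'I_t -> 'I_n}) := \prod_(m < t) lss_prob U (j m).
have w_ge0 j : 0 <= w j by apply: prodr_ge0 => m _; apply: lss_prob_ge0.
have Y_ge0 j : 0 <= Y j by rewrite addr_ge0 ?fsq_ge0.
have b_ge0 : 0 <= b by rewrite /b -PQ addr_ge0 ?fsq_ge0.
have mean : \sum_j w j * Y j <= kappa * b.
  under eq_bigr do rewrite mulrDr.
  rewrite big_split /= /b -PQ mulrDr; apply: lerD.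
    apply: le_trans (lss_sketch_mean r_gt0 UU t_gt0 P) _.
    by rewrite ler_wpM2r ?fsq_ge0.
  apply: le_trans (lss_sketch_mean r_gt0 UU t_gt0 Q) _.
  by rewrite ler_wpM2r ?fsq_ge0.
have tail : \sum_(j | Delta * b < Y j) w j <= kappa / Delta.
  have [b_le0|b_gt0] := leP b 0; last exact: markov_finite mean.
  (* B = 0: the factors vanish, and so does Y at every draw *)
  have PQ0 : fsq P + fsq Q = 0.
    by apply/eqP; rewrite eq_le addr_ge0 ?fsq_ge0 // andbT PQ.
  have := fsq_ge0 P; have := fsq_ge0 Q => Q_ge0 P_ge0.
  have P0 : P = 0 by apply: fsq_eq0; lra.
  have Q0 : Q = 0 by apply: fsq_eq0; lra.
  rewrite big1 ?divr_ge0 ?(ltW Delta_gt0) // => j.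
  rewrite /Y /L P0 Q0 !mulmx0 fsq0 addr0 ltNge mulr_ge0 //.
  exact: ltW.
have good j : subspace_embedding eps (lss_mx U j) U -> Y j <= Delta * b ->
    nuclear_norm (A - C *m Mhat j *m C^T)
      <= (1 + Delta / c ^+ 2) * nuclear_norm B.
  move=> embj Yle; have [/= Mmin _] := Mhat_min j.
  set S := lss_mx U j in embj Mmin *.
  pose K := T *m (Mhat j - Mstar) *m T^T.
  have BhE : A - C *m Mhat j *m C^T = P *m Q^T - U *m K *m U^T.
    rewrite -BE /B /K CE trmx_mul mulmxBr mulmxBl mulmxBr mulmxBl !mulmxA.
    by rewrite opprB addrA addrNK.
  have E : (S *m C)^T *m (S *m (A - C *m Mhat j *m C^T) *m S^T) *m (S *m C) = 0.
    have SE M : S *m (A - C *m M *m C^T) *m S^T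
        = S *m A *m S^T - S *m C *m M *m (S *m C)^T.
      by rewrite mulmxBr mulmxBl trmx_mul !mulmxA.
    rewrite SE; apply: argmin_congruence_normal_eq => M.
    by have := Mmin M; rewrite /= !SE.
  have neq : (S *m U)^T *m (S *m (P *m Q^T - U *m K *m U^T) *m S^T) *m (S *m U)
      = 0.
    have TTu : T^T \in unitmx by rewrite unitmx_tr.
    rewrite -BhE; set Z := _ *m S^T in E *.
    apply: (can_inj (mulmxK Tu)); apply: (can_inj (mulKmx TTu)).
    by rewrite mul0mx mulmx0 -E CE !trmx_mul !mulmxA.
  have lb l (X : 'M[R]_(r, l)) : c * fsq X <= fsq (S *m U *m X).
    exact: fsq_embedding.
  have := nuclear_norm_sketch_residual UU c_gt0 lb neq.
  rewrite -BhE PQ -/(L j P) -/(L j Q) -/(Y j).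
  have := ler_wpM2r (_ : 0 <= (c ^+ 2)^-1) Yle.
  rewrite invr_ge0 exprn_ge0 ?(ltW c_gt0) // => /(_ isT).
  rewrite /b; set N := nuclear_norm B; set i := _^-1 => le1 le2.
  by lra.
(* a good draw that misses the bound must exceed the Markov threshold *)
rewrite opprD addrA addrAC lerBlDr; apply: le_trans emb _.
apply: le_trans (lerD (lexx _) tail).
rewrite /lss_Pr [leLHS]big_mkcond [X in X + _]big_mkcond.
rewrite [X in _ + X]big_mkcond -big_split /=.
apply: ler_sum => j _; rewrite -/(w j).
case: ifPn => [|_]; last by rewrite addr_ge0 //; case: ifP.
rewrite inE /= => embj; case: ltP => [_|Yle].
  by rewrite lerDr; case: ifP.
by rewrite addr0 mem_set //=; apply: good.
Qed.
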